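(* If $G$ is a plane graph, then \[ P(G;\lambda)=\sum_{A\subseteq E(G)}\chi\big((G^{\tau(A)})^*;\lambda\big). \]
   Context: A plane graph is a graph cellularly embedded in the sphere; in general an embedded graph is a cellularly embedded graph in a closed (possibly non-orientable) surface, equivalently a ribbon graph, encoded by an arrow presentation (one circle per vertex carrying disjoint arrows, each edge label appearing on exactly two arrows marking where that edge attaches, oriented consistently with an orientation of the edge disc; equivalent up to reversing both arrows of a label and relabelling). For $A\subseteq E(G)$, the partial Petrial $G^{\tau(A)}$ is obtained by reversing exactly one of the two arrows of each label in $A$ (a half-twist on each edge in $A$). $H^*$ denotes the geometric dual of an embedded graph $H$, and $\chi(H;\lambda)$ is the chromatic polynomial of the underlying abstract graph of $H$. Penrose polynomial: the medial graph $G_m$ has a degree-4 vertex $v_e$ on each edge $e$ of $G$, with edges following face boundaries of $G$ (an isolated vertex contributes a vertex-free closed curve); faces of $G_m$ containing a vertex of $G$ are black, others white. At $v_e$: the white split pairs consecutive half-edges bounding white corners, the black split those bounding black corners, the crossing pairs opposite half-edges. A state $s$ chooses a vertex state at each vertex; $c(s)$ = number of resulting closed curves, $cr(s)$ = number of crossings; Penrose states have no black split; $P(G;\lambda)=\sum_{s\text{ Penrose}}(-1)^{cr(s)}\lambda^{c(s)}$. *)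

(* Defs.v *)
From HB Require Import structures.
From mathcomp Require Import all_boot all_order all_algebra.

Set Implicit Arguments.
Unset Strict Implicit.
Unset Printing Implicit Defensive.

Import Order.TTheory GRing.Theory Num.Theory.
Local Open Scope ring_scope.

(* Used only for families of involutions, for which [connect] is an equivalence
   relation. *)
Definition step (T : finType) (fs : seq (T -> T)) : rel T :=
  [rel x y | has (fun f => f x == y) fs].

Definition orbits (T : finType) (fs : seq (T -> T)) : {set {set T}} :=
  equivalence_partition (connect (step fs)) [set: T].

Definition orbit_type (T : finType) (fs : seq (T -> T)) : finType :=
  {B : {set T} | B \in orbits fs}.

Definition orbit_of (T : finType) (fs : seq (T -> T)) (x : T) :
    orbit_type fs :=
  exist _ [set y in [set: T] | connect (step fs) x y]
        (imset_f _ (in_setT x)).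

Record multigraph : Type := Multigraph {
  gvertex : finType;
  gedge : finType;
  gends : gedge -> gvertex * gvertex
}.

Definition proper_colouring (H : multigraph) (k : nat)
    (c : {ffun gvertex H -> 'I_k}) : bool :=
  [forall e : gedge H, c (gends e).1 != c (gends e).2].

Definition num_colourings (H : multigraph) (k : nat) : nat :=
  #|[set c : {ffun gvertex H -> 'I_k} | proper_colouring c]|.

Section ChromaticPolynomialExists.
Variable H : multigraph.
Notation V := (gvertex H).
Notation E := (gedge H).

Definition constant_on (F : {set E}) (k : nat) (c : {ffun V -> 'I_k}) : bool :=
  [forall e in F, c (gends e).1 == c (gends e).2].

Let adj (F : {set E}) : rel V := [rel x y |
  [exists e in F, (gends e == (x, y)) || (gends e == (y, x))]].

Let adj_sym F : connect_sym (adj F).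
Proof.
apply: sym_connect_sym => x y /=.
by apply: eq_existsb => e; rewrite orbC.
Qed.

Lemma constant_onE F k (c : {ffun V -> 'I_k}) :
  constant_on F c = [forall x, c (fingraph.root (adj F) x) == c x].
Proof.
apply/forall_inP/forallP => [cF x | cR e eF].
  suff cc y : connect (adj F) x y -> c y = c x.
    by apply/eqP/cc/connect_root.
  case/connectP=> p + ->; elim: p x => //= z p IH x /andP[/exists_inP[e eF exz]].
  move/IH->; move: (cF e eF); case/orP: exz => /eqP-> /= /eqP //.
rewrite -(eqP (cR (gends e).1)) -(eqP (cR (gends e).2)); apply/eqP; congr (c _).
apply/(fingraph.rootP (adj_sym F)); apply: connect1; apply/exists_inP; exists e => //.
by rewrite -surjective_pairing eqxx.
Qed.

Lemma card_constant_on F k :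
  #|[set c : {ffun V -> 'I_k} | constant_on F c]|
  = (k ^ #|{: {x : V | fingraph.root (adj F) x == x}}|)%N.
Proof.
pose R := {x : V | fingraph.root (adj F) x == x}.
have rr x : fingraph.root (adj F) (fingraph.root (adj F) x) == fingraph.root (adj F) x.
  by rewrite (fingraph.root_root (adj_sym F)).
pose ext (g : {ffun R -> 'I_k}) : {ffun V -> 'I_k} :=
  [ffun x => g (exist _ (fingraph.root (adj F) x) (rr x))].
have ext_inj : injective ext.
  move=> g1 g2 /ffunP eg; apply/ffunP=> -[x xP].
  have := eg x; rewrite !ffunE.
  by have -> : exist _ (fingraph.root (adj F) x) (rr x) = exist _ x xP :> R
    by apply: val_inj; apply/eqP.
rewrite -[k in RHS]card_ord -card_ffun -(card_imset predT ext_inj).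
apply: eq_card => c; rewrite inE constant_onE; apply/forallP/imsetP.
  move=> cR; exists [ffun z : R => c (val z)] => //.
  by apply/ffunP=> x; rewrite !ffunE /=; apply/esym/eqP.
case=> g _ -> x; rewrite !ffunE; apply/eqP; congr (g _).
by apply: val_inj; apply/eqP; apply: rr.
Qed.

Lemma chromatic_poly_exists :
  {p : {poly int} | forall k : nat, p.[k%:R] = (num_colourings H k)%:R}.
Proof.
exists (\sum_(F : {set E})
          (-1) ^+ #|F| *: 'X^(#|{: {x : V | fingraph.root (adj F) x == x}}|)) => k.
rewrite horner_sum /num_colourings -sum1_card natr_sum.
transitivity (\sum_(c : {ffun V -> 'I_k}) \prod_(e : E)
    (- (c (gends e).1 == c (gends e).2)%:R + 1) : int); last first.
  rewrite [RHS]big_mkcond /=; apply: eq_bigr => c _; rewrite inE.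
  case: ifPn => [/forallP pc | /forallPn[e]].
    by apply: big1 => e _; rewrite (negbTE (pc e)) oppr0 add0r.
  by rewrite negbK => ce; rewrite (bigD1 e) //= ce addNr mul0r.
transitivity (\sum_(c : {ffun V -> 'I_k}) \sum_(F : {set E})
    (-1) ^+ #|F| * (constant_on F c)%:R : int).
  rewrite exchange_big; apply: eq_bigr => F _ /=.
  rewrite hornerZ hornerXn -natrX -card_constant_on -mulr_sumr.
  congr (_ * _); rewrite -sum1_card natr_sum [LHS]big_mkcond /=.
  by apply: eq_bigr => c _; rewrite inE; case: ifP.
apply: eq_bigr => c _; rewrite bigA_distr /=; apply: eq_bigr => F _.
rewrite [in RHS](bigID (mem F)) /= [X in _ = _ * X]big1 ?mulr1; last first.
  by move=> e /negbTE->.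
rewrite (eq_bigr (fun e => - (c (gends e).1 == c (gends e).2)%:R)); last first.
  by move=> e ->.
rewrite prodrN; congr (_ * _).
case: (boolP (constant_on F c)) => [/forall_inP cF | /forall_inPn[e eF ne]].
  by rewrite big1 // => e /cF->.
by rewrite (bigD1 e) //= (negbTE ne) mul0r.
Qed.

End ChromaticPolynomialExists.

Definition chromatic_poly (H : multigraph) : {poly int} :=
  sval (chromatic_poly_exists H).

Lemma chromatic_polyP (H : multigraph) (k : nat) :
  (chromatic_poly H).[k%:R] = (num_colourings H k)%:R.
Proof. exact: (svalP (chromatic_poly_exists H)). Qed.

Lemma chromatic_poly_unique (H : multigraph) (p : {poly int}) :
  (forall k : nat, p.[k%:R] = (num_colourings H k)%:R) ->
  p = chromatic_poly H.
Proof.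
move=> pP; apply/eqP; rewrite -subr_eq0; apply/negPn/negP => nz.
pose rs := [seq (k%:R : int) | k <- iota 0 (size (p - chromatic_poly H))].
have urs : uniq rs.
  rewrite map_inj_uniq ?iota_uniq // => i j ij.
  by apply/eqP; rewrite -(eqr_nat int); apply/eqP.
have ars : all (root (p - chromatic_poly H)) rs.
  apply/allP=> _ /mapP[k _ ->].
  by rewrite rootE hornerD hornerN pP chromatic_polyP subrr.
by have := max_poly_roots nz ars urs; rewrite size_map size_iota ltnn.
Qed.

(* The two arrows with label [e] are [(e, false)] and [(e, true)]; the tail of
   the arrow [(e, i)] is [(e, i, false)] and its head is [(e, i, true)]. *)
Definition arrow_end (E : finType) : finType := (E * bool * bool)%type.

(* [arc] joins two arrow ends when they are the ends of one of the arcs that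
   remain when the arrows are removed from the circles.  The arrows and the
   arcs, taken alternately, form the circles that carry at least one arrow, so
   that every fixed-point-free involution [arc] comes from exactly one arrow
   presentation, up to the number [bare] of circles without arrows (the
   isolated vertices). *)
Record embedded_graph : Type := EmbeddedGraph {
  edge : finType;
  arc : arrow_end edge -> arrow_end edge;
  arcK : involutive arc;
  arc_neq : forall x, arc x != x;
  bare : nat
}.

Definition along_arrow (E : finType) (x : arrow_end E) : arrow_end E :=
  let: (e, i, h) := x in (e, i, ~~ h).

(* Both arrows of a label agree with an orientation of the boundary of the edge
   disc, hence each free side of the disc joins the head of one of the arrows
   to the tail of the other. *)
Definition along_side (E : finType) (x : arrow_end E) : arrow_end E :=
  let: (e, i, h) := x in (e, ~~ i, ~~ h).

(* An isolated vertex has its own circle, its own face and its own component. *)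
Definition vertex (G : embedded_graph) : finType :=
  (orbit_type [:: @along_arrow (edge G); @arc G] + 'I_(bare G))%type.

Definition face (G : embedded_graph) : finType :=
  (orbit_type [:: @along_side (edge G); @arc G] + 'I_(bare G))%type.

Definition component (G : embedded_graph) : finType :=
  (orbit_type [:: @along_arrow (edge G); @along_side (edge G); @arc G]
   + 'I_(bare G))%type.

(* The sphere is the connected closed surface of Euler characteristic 2; a
   graph cellularly embedded in a connected surface is connected. *)
Definition plane (G : embedded_graph) : Prop :=
  #|component G| = 1%N /\ (#|vertex G| + #|face G| = #|edge G| + 2)%N.

Definition arrow_vertex (G : embedded_graph) (e : edge G) (i : bool) :
    vertex G :=
  inl (orbit_of [:: @along_arrow (edge G); @arc G] (e, i, false)).

Definition underlying (G : embedded_graph) : multigraph :=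
  @Multigraph (vertex G) (edge G)
    (fun e => (arrow_vertex e false, arrow_vertex e true)).

Section Renaming.
Variables (G : embedded_graph) (f g : arrow_end (edge G) -> arrow_end (edge G)).
Hypotheses (fK : cancel f g) (gK : cancel g f).

Fact rename_arcK : involutive (fun x => g (arc (f x))).
Proof. by move=> x; rewrite gK arcK fK. Qed.

Fact rename_arc_neq x : g (arc (f x)) != x.
Proof. by rewrite -{2}[x]fK (can_eq gK) arc_neq. Qed.

(* The arrow presentation with the same arcs as [G], whose arrow end named [x]
   is located at the arrow end [f x] of [G]. *)
Definition rename_ends : embedded_graph :=
  @EmbeddedGraph (edge G) (fun x => g (arc (f x)))
    rename_arcK rename_arc_neq (bare G).

End Renaming.

Definition reverse_arrows (E : finType) (A : {set E}) (x : arrow_end E) :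
    arrow_end E :=
  let: (e, i, h) := x in (e, i, h (+) (i && (e \in A))).

Fact reverse_arrowsK (E : finType) (A : {set E}) :
  involutive (reverse_arrows A).
Proof. by move=> [[e i] h] /=; rewrite addbK. Qed.

(* Of the two arrows labelled [e \in A], exactly [(e, true)] is reversed. *)
Definition partial_petrial (G : embedded_graph) (A : {set edge G}) :
    embedded_graph :=
  rename_ends (reverse_arrowsK A) (reverse_arrowsK A).

(* The vertex discs of the dual are glued to the edge discs of [G] along their
   free sides.  The arrow [(e, i)] of the dual is the side of [e] directed from
   the head of the arrow [(e, i)] of [G] to the tail of [(e, ~~ i)]; these
   directions again agree with the orientation of the edge disc. *)
Definition dual_end (E : finType) (x : arrow_end E) : arrow_end E :=
  let: (e, i, h) := x in (e, i (+) h, ~~ h).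

Definition dual_end_inv (E : finType) (x : arrow_end E) : arrow_end E :=
  let: (e, i, h) := x in (e, i (+) ~~ h, ~~ h).

Fact dual_endK (E : finType) : cancel (@dual_end E) (@dual_end_inv E).
Proof. by move=> [[e []] []]. Qed.

Fact dual_end_invK (E : finType) : cancel (@dual_end_inv E) (@dual_end E).
Proof. by move=> [[e []] []]. Qed.

Definition dual (G : embedded_graph) : embedded_graph :=
  rename_ends (@dual_endK (edge G)) (@dual_end_invK (edge G)).

(* The edges of the medial graph run along the arcs of the vertex circles: its
   half-edges are the arrow ends, [arc] pairs the two halves of each edge, and
   the half-edges at the vertex [v_e] are the four arrow ends labelled [e], in
   the cyclic order of the boundary of the edge disc
     [(e, false, false)], [(e, false, true)], [(e, true, false)],
     [(e, true, true)].
   The corner between the two ends of an arrow lies at a vertex of [G] and is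
   black; the corner between the two ends of a side of the edge disc lies in a
   face of [G] and is white. *)
Variant vertex_state : Type := white_split | black_split | crossing.

Definition code_vertex_state (t : vertex_state) : option bool :=
  match t with
  | white_split => Some false
  | black_split => None
  | crossing => Some true
  end.

Definition decode_vertex_state (o : option bool) : vertex_state :=
  match o with
  | Some false => white_split
  | None => black_split
  | Some true => crossing
  end.

Fact code_vertex_stateK : cancel code_vertex_state decode_vertex_state.
Proof. by case. Qed.

HB.instance Definition _ := Finite.copy vertex_state (can_type code_vertex_stateK).

Definition state (G : embedded_graph) : finType := {ffun edge G -> vertex_state}.

Definition state_pairing (G : embedded_graph) (s : state G)
    (x : arrow_end (edge G)) : arrow_end (edge G) :=
  let: (e, i, h) := x in
  match s e with
  | white_split => along_side x
  | black_split => along_arrow x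
  | crossing => (e, ~~ i, h)
  end.

(* An isolated vertex of [G] gives a closed curve without vertices. *)
Definition curve (G : embedded_graph) (s : state G) : finType :=
  (orbit_type [:: state_pairing s; @arc G] + 'I_(bare G))%type.

Definition num_crossings (G : embedded_graph) (s : state G) : nat :=
  #|[set e | s e == crossing]|.

Definition penrose_state (G : embedded_graph) (s : state G) : bool :=
  [forall e, s e != black_split].

Definition penrose_poly (G : embedded_graph) : {poly int} :=
  \sum_(s : state G | penrose_state s)
     (-1) ^+ num_crossings s *: 'X^(#|curve s|).

(* Main.v *)
(**
Evaluate both sides at a natural number k.  Up to the factor contributed by the
isolated vertices, both become sums over the colourings of the edges of the
medial graph with k colours: the left side weighs such a colouring by the
product over the medial vertices of [white pairs agree] - [opposite pairs
agree], while the faces of a partial Petrial are the curves of the state that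
crosses exactly at the twisted edges, so the right side counts the colourings
for which exactly one of the two agreements holds at every vertex.  The two sums
coincide once such a colouring has an even number of crossings.

This parity is a Jordan curve argument over F_2.  For a family of involutions of
the arrow ends, the functions invariant under it form a space whose dimension
is the number of orbits.  The Euler characteristic of the sphere makes the sum
of the spaces for vertices and for faces as large as the orthogonal of the sum
of the spaces for arcs and for edges, so these two are equal, and the set of
medial edges coloured below b separates the medial faces into two classes.  The
curves of colour b cross it evenly often; sum over b.
*)

From Stdlib Require List.
From mathcomp Require Import all_boot all_order all_algebra zify.
Require Import Defs.

Set Implicit Arguments.
Unset Strict Implicit.
Unset Printing Implicit Defensive.

Import GRing.Theory Num.Theory.
Local Open Scope ring_scope.

(** * Orbits and invariant functions *)

(** Membership is [List.In], since functions on a general [eqType] have no decidable equality. *)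
Definition invariant_fun (T X : eqType) (fs : seq (T -> T)) (c : T -> X) : Prop :=
  forall f x, List.In f fs -> c (f x) = c x.

Lemma has_In (S : Type) (a : pred S) (s : seq S) :
  has a s <-> exists2 z, List.In z s & a z.
Proof.
elim: s => [|y s IH] /=; first by split=> // -[].
split=> [/orP[ay | /IH[z zs az]] | [z [<-|zs] az]].
- by exists y; [left|].
- by exists z; [right|].
- by rewrite az.
- by apply/orP; right; apply/IH; exists z.
Qed.

Section Orbits.
Variables (T : finType) (fs : seq (T -> T)).

Lemma invariant_connect (X : eqType) (c : T -> X) x y :
  invariant_fun fs c -> connect (step fs) x y -> c y = c x.
Proof.
move=> inv_c /connectP[p + ->]; elim: p x => //= z p IH x /andP[xz /IH->].
by case/has_In: xz => f ffs /eqP<-; apply: inv_c.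
Qed.

Hypothesis fsK : forall f, List.In f fs -> involutive f.

Lemma step_connect_sym : connect_sym (step fs).
Proof.
apply: sym_connect_sym => x y /=.
by apply/idP/idP=> /has_In[f ffs /eqP<-]; apply/has_In;
  exists f => //; rewrite fsK.
Qed.

Lemma connect_equivalence : {in [set: T] & &, equivalence_rel (connect (step fs))}.
Proof.
move=> x y z _ _ _; split=> [|xy]; first exact: connect0.
apply/idP/idP; last exact: connect_trans.
by apply: connect_trans; rewrite step_connect_sym.
Qed.

Lemma orbit_of_eq x y :
  (orbit_of fs x == orbit_of fs y) = connect (step fs) x y.
Proof.
apply/eqP/idP => [/(congr1 val)/setP/(_ y)|xy].
  by rewrite !inE connect0.
apply: val_inj; apply/setP=> z; rewrite !inE /=.
by have [_ ->] := connect_equivalence (in_setT x) (in_setT y) (in_setT z).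
Qed.

Lemma orbit_of_invariant : invariant_fun fs (orbit_of fs).
Proof.
move=> f x ffs; apply/eqP; rewrite orbit_of_eq step_connect_sym.
by apply: connect1; apply/has_In; exists f.
Qed.

Lemma orbit_of_surj (B : orbit_type fs) : exists x, orbit_of fs x == B.
Proof.
case: B => B BO; have /imsetP[x _ BE] := BO.
by exists x; apply/eqP/val_inj; rewrite /= BE.
Qed.

Definition orbit_repr (B : orbit_type fs) : T := xchoose (orbit_of_surj B).

Lemma orbit_reprK B : orbit_of fs (orbit_repr B) = B.
Proof. exact/eqP/(xchooseP (orbit_of_surj B)). Qed.

Lemma invariant_repr (X : eqType) (c : T -> X) x :
  invariant_fun fs c -> c (orbit_repr (orbit_of fs x)) = c x.
Proof.
move/invariant_connect; apply.
by rewrite -orbit_of_eq orbit_reprK.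
Qed.

Lemma card_orbits_uniform n :
  (forall x, #|[set y in [set: T] | connect (step fs) x y]| = n) ->
  (#|{: orbit_type fs}| * n = #|T|)%N.
Proof.
move=> cardn; rewrite card_sig -cardsT.
have /card_uniform_partition cardP := equivalence_partitionP connect_equivalence.
by rewrite (cardP n) // => B /imsetP[x _ ->].
Qed.

(** A colouring of the orbits and of [b] extra points amounts to an invariant colouring of [T] and a
    free choice at each extra point; [P] sees only the former. *)
Lemma card_orbit_colourings (X : finType) (b : nat) (P : pred {ffun T -> X})
    (I : pred {ffun T -> X}) :
  (forall c : {ffun T -> X}, reflect (invariant_fun fs c) (I c)) ->
  #|[set c : {ffun orbit_type fs + 'I_b -> X}
      | P [ffun x => c (inl (orbit_of fs x))]]|
  = (#|[set c : {ffun T -> X} | I c && P c]| * #|X| ^ b)%N.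
Proof.
move=> IP.
pose h (c : {ffun orbit_type fs + 'I_b -> X}) :
    {ffun T -> X} * {ffun 'I_b -> X} :=
  ([ffun x => c (inl (orbit_of fs x))], [ffun i => c (inr i)]).
have h_inj : injective h.
  move=> c1 c2 [/ffunP e1 /ffunP e2]; apply/ffunP=> -[B|i].
    by have := e1 (orbit_repr B); rewrite !ffunE orbit_reprK.
  by have := e2 i; rewrite !ffunE.
rewrite -(card_imset _ h_inj).
have -> : (#|X| ^ b = #|[set: {ffun 'I_b -> X}]|)%N.
  by rewrite cardsT card_ffun card_ord.
rewrite -cardsX; apply: eq_card => -[c d]; apply/imsetP/idP.
  case=> u; rewrite inE => Pu [-> ->]; rewrite !inE andbT Pu andbT.
  by apply/IP=> f x ffs; rewrite !ffunE orbit_of_invariant.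
rewrite !inE andbT => /andP[/IP inv_c Pc].
pose u : {ffun orbit_type fs + 'I_b -> X} :=
  [ffun z => match z with inl B => c (orbit_repr B) | inr i => d i end].
have uc : [ffun x => u (inl (orbit_of fs x))] = c.
  by apply/ffunP=> x; rewrite !ffunE invariant_repr.
exists u; first by rewrite inE uc.
by congr pair; [rewrite uc | apply/ffunP=> i; rewrite !ffunE].
Qed.

End Orbits.

(** * The space of invariant vectors *)

(** [V + F] lies in the orthogonal of [A] and [B]. Its rank is [a + b - r], that of the orthogonal
    is [n - (c + d - s)], and the numerical hypothesis makes them equal. *)
Lemma sub_sum_orthogonal (K : fieldType) n a b c d r s
    (V : 'M[K]_(a, n)) (F : 'M[K]_(b, n)) (A : 'M[K]_(c, n)) (B : 'M[K]_(d, n)) :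
  (forall u : 'rV_n, (u <= V)%MS -> u *m A^T = 0 /\ u *m B^T = 0) ->
  (forall u : 'rV_n, (u <= F)%MS -> u *m A^T = 0 /\ u *m B^T = 0) ->
  \rank V = a -> \rank F = b -> \rank A = c -> \rank B = d ->
  \rank (V :&: F)%MS = r -> \rank (A :&: B)%MS = s ->
  (a + b + (c + d) = n + (r + s))%N ->
  forall u : 'rV_n, u *m A^T = 0 -> u *m B^T = 0 -> (u <= V + F)%MS.
Proof.
move=> orthV orthF rV rF rA rB rVF rAB rk u uA uB; pose S := col_mx A B.
have mulS (v : 'rV_n) : v *m A^T = 0 /\ v *m B^T = 0 -> (v <= kermx S^T)%MS.
  by case=> vA vB; apply/sub_kermxP; rewrite tr_col_mx mul_mx_row vA vB row_mx0.
have subS : (V + F <= kermx S^T)%MS.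
  rewrite addsmx_sub; apply/andP; split; apply/rV_subP=> v.
    by move/orthV/mulS.
  by move/orthF/mulS.
have /eqP : \rank (V + F)%MS = \rank (kermx S^T).
  rewrite mxrank_ker mxrank_tr -addsmxE.
  have := mxrank_sum_cap V F; have := mxrank_sum_cap A B.
  rewrite rV rF rA rB rVF rAB; lia.
rewrite mxrank_leqif_sup // => /(submx_trans _); apply.
exact: mulS.
Qed.

Section InvariantVectors.
Variables (T : finType) (K : fieldType).

Definition vec_of (u : T -> K) : 'rV[K]_#|T| := \row_j u (enum_val j).
Definition fun_of (u : 'rV[K]_#|T|) (x : T) : K := u 0 (enum_rank x).

Lemma fun_of_vecK u x : fun_of (vec_of u) x = u x.
Proof. by rewrite /fun_of mxE enum_rankK. Qed.

(** The rows are the indicator vectors of the orbits. *)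
Definition orbit_mx (fs : seq (T -> T)) : 'M[K]_(#|{: orbit_type fs}|, #|T|) :=
  \matrix_(i, j) (enum_val i == orbit_of fs (enum_val j))%:R.

Lemma mul_orbit_mx fs m (w : 'M_(m, _)) i j :
  (w *m orbit_mx fs) i j = w i (enum_rank (orbit_of fs (enum_val j))).
Proof.
rewrite mxE (bigD1 (enum_rank (orbit_of fs (enum_val j)))) //=.
rewrite mxE enum_rankK eqxx mulr1 big1 ?addr0 // => l nl.
rewrite mxE (_ : _ == _ = false) ?mulr0 //.
by apply: contraNF nl => /eqP<-; rewrite enum_valK.
Qed.

Lemma mul_orbit_mxT fs (u : 'rV_#|T|) i :
  (u *m (orbit_mx fs)^T) 0 i
  = \sum_x fun_of u x * (enum_val i == orbit_of fs x)%:R.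
Proof.
rewrite mxE (reindex_onto (@enum_rank T) enum_val) /=; last first.
  by move=> j _; rewrite enum_valK.
apply: eq_big => [x|x _]; first by rewrite enum_rankK eqxx.
by rewrite !mxE enum_rankK.
Qed.

Section OneFamily.
Variable fs : seq (T -> T).
Hypothesis fsK : forall f, List.In f fs -> involutive f.

Lemma orbit_mx_free : row_free (orbit_mx fs).
Proof.
(* The right inverse selects, for each orbit, the column of its representative. *)
apply/row_freeP; exists (\matrix_(j, i)
  (enum_val j == orbit_repr (enum_val i))%:R).
apply/matrixP=> i l; rewrite !mxE (bigD1 (enum_rank (orbit_repr (enum_val l)))) //=.
rewrite !mxE enum_rankK eqxx mulr1 orbit_reprK big1 ?addr0; last first.
  move=> j nj; rewrite !mxE (_ : (enum_val j == _) = false) ?mulr0 //.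
  by apply: contraNF nj => /eqP<-; rewrite enum_valK.
by rewrite (inj_eq enum_val_inj).
Qed.

Lemma rank_orbit_mx : \rank (orbit_mx fs) = #|{: orbit_type fs}|.
Proof. exact/eqP/orbit_mx_free. Qed.

Lemma sub_orbit_mxP (u : 'rV_#|T|) :
  (u <= orbit_mx fs)%MS <-> invariant_fun fs (fun_of u).
Proof.
split=> [/submxP[w ->] f x ffs | inv_u].
  by rewrite /fun_of !mul_orbit_mx !enum_rankK orbit_of_invariant.
apply/submxP; exists (\row_i fun_of u (orbit_repr (enum_val i))).
apply/rowP=> j; rewrite mul_orbit_mx mxE enum_rankK invariant_repr //.
by rewrite /fun_of enum_valK.
Qed.

End OneFamily.

Lemma rank_cap_orbit_mx fs1 fs2 fs :
  (forall f, List.In f fs1 -> involutive f) ->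
  (forall f, List.In f fs2 -> involutive f) ->
  (forall f, List.In f fs -> involutive f) ->
  (forall f, List.In f fs <-> List.In f fs1 \/ List.In f fs2) ->
  \rank (orbit_mx fs1 :&: orbit_mx fs2)%MS = #|{: orbit_type fs}|.
Proof.
move=> fs1K fs2K fsK fsE; rewrite -(rank_orbit_mx fs); apply/eqmx_rank/andP.
split; apply/rV_subP=> u; rewrite sub_capmx.
  move=> /andP[/(sub_orbit_mxP fs1K) u1 /(sub_orbit_mxP fs2K) u2].
  by apply/(sub_orbit_mxP fsK) => f x /fsE[]; [apply: u1 | apply: u2].
move/(sub_orbit_mxP fsK) => inv_u; apply/andP; split.
  by apply/(sub_orbit_mxP fs1K) => f x ?; apply/inv_u/fsE; left.
by apply/(sub_orbit_mxP fs2K) => f x ?; apply/inv_u/fsE; right.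
Qed.

End InvariantVectors.

(** The terms at [x] and [s x] cancel. The order of [enum_rank] selects one point of each pair, and
    [s] exchanges the selected points with the others. *)
Lemma sum_involution_char2 (T : finType) (R : nzRingType) (s : T -> T) (F : T -> R) :
  2%N \in [pchar R] -> involutive s -> (forall x, s x != x) ->
  (forall x, F (s x) = F x) -> \sum_x F x = 0.
Proof.
move=> R2 sK s_neq Fs.
rewrite (bigID (fun x => enum_rank x < enum_rank (s x))%N) /=.
rewrite [X in _ + X](reindex_inj (inv_inj sK)) /= -[RHS](addrr_pchar2 R2 
  (\sum_(x | (enum_rank x < enum_rank (s x))%N) F x)).
congr (_ + _); apply: eq_big => [x|x _]; last exact: Fs.
rewrite sK -leqNgt leq_eqVlt; case: eqP => // /val_inj/enum_rank_inj/eqP.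
by rewrite eq_sym (negbTE (s_neq x)).
Qed.

(** * Parity of crossings in the sphere *)

Lemma along_arrowK (E : finType) : involutive (@along_arrow E).
Proof. by case=> [[e i] h]; rewrite /= negbK. Qed.

Lemma along_sideK (E : finType) : involutive (@along_side E).
Proof. by case=> [[e i] h]; rewrite /= !negbK. Qed.

Lemma along_arrow_neq (E : finType) (x : arrow_end E) : along_arrow x != x.
Proof. by case: x => [[e []] []]; rewrite !xpair_eqE /= !andbF. Qed.

Lemma along_side_neq (E : finType) (x : arrow_end E) : along_side x != x.
Proof. by case: x => [[e []] []]; rewrite !xpair_eqE /= !andbF. Qed.

Lemma card_arrow_end (E : finType) : #|arrow_end E| = (4 * #|E|)%N.
Proof. by rewrite !card_prod card_bool -mulnA mulnC. Qed.

Lemma sum_arrow_end (E : finType) (R : nmodType) (F : arrow_end E -> R) :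
  \sum_x F x = \sum_e (F (e, false, false) + F (e, false, true)
                       + (F (e, true, false) + F (e, true, true))).
Proof.
transitivity (\sum_e \sum_i \sum_h F (e, i, h)).
  by rewrite pair_bigA pair_bigA; apply: eq_bigr => -[[]].
by apply: eq_bigr => e _; rewrite !big_bool /= addrC [X in X + _]addrC [X in _ + X]addrC.
Qed.

Lemma card_sum_ord (S : finType) (b : nat) :
  #|{: S + 'I_b}| = (#|S| + b)%N.
Proof. by rewrite card_sum card_ord. Qed.

(* Stated for variables only: the unifier must not be allowed to compare the
   orbit types of distinct families. *)
Lemma sphere_dimension (v f c a k e b n : nat) :
  (c + b = 1)%N -> (v + b + (f + b) = e + 2)%N ->
  a = (2 * e)%N -> k = e -> n = (4 * e)%N ->
  (v + f + (a + k) = n + (c + c))%N.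
Proof. lia. Qed.

Section Sphere.
Variable G : embedded_graph.
Notation E := (edge G).
Notation T := (arrow_end E).
Notation K := 'F_2.
Notation arrow_f := (@along_arrow E).
Notation side_f := (@along_side E).
Notation arc_f := (@arc G).

Let K2 : 2%N \in [pchar K]. Proof. exact: pchar_Fp. Qed.

Lemma card_arc_orbits : #|{: orbit_type [:: arc_f]}| = (2 * #|E|)%N.
Proof.
have fsK f : List.In f [:: arc_f] -> involutive f.
  by case=> [<-|[]]; exact: arcK.
apply/eqP; rewrite -(eqn_pmul2r (isT : 0 < 2)%N).
rewrite (card_orbits_uniform fsK (n := 2)) ?card_arrow_end; last first.
  (* As [arc] has no fixed point, 2 is [(x != arc x).+1], the cardinality of the set of [x] and
     [arc x]. *)
  move=> x; rewrite -[RHS]/(true.+1) -(arc_neq (arc x)) arcK -cards2.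
  apply: eq_card => y; rewrite !inE /=; apply/idP/orP; last first.
    by case=> /eqP->; [exact: connect0 | apply: connect1; rewrite /step /= eqxx].
  case/connectP=> p + ->; elim/last_ind: p => [|p z IH]; first by left.
  rewrite rcons_path last_rcons => /andP[/IH + ].
  by rewrite /step /= orbF => -[]/eqP-> /eqP<-; [right | left; rewrite arcK].
by rewrite mulnAC.
Qed.

Lemma block_connect e i h j l :
  connect (step [:: arrow_f; side_f]) (e, i, h) (e, j, l).
Proof.
have arr x : connect (step [:: arrow_f; side_f]) x (arrow_f x).
  by apply: connect1; rewrite /step /= eqxx.
have sid x : connect (step [:: arrow_f; side_f]) x (side_f x).
  by apply: connect1; rewrite /step /= eqxx orbT.
case: (eqVneq i j) (eqVneq h l) => [<-|ij] [<-|hl].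
- exact: connect0.
- by have := arr (e, i, h); rewrite /=; case: h l hl => [] [].
- have := connect_trans (arr (e, i, h)) (sid _).
  by rewrite /= negbK; case: i j ij => [] [].
- by have := sid (e, i, h); rewrite /=; case: i j ij h l hl => [] [] //= _ [] [].
Qed.

Lemma card_block_orbits : #|{: orbit_type [:: arrow_f; side_f]}| = #|E|.
Proof.
have fsK f : List.In f [:: arrow_f; side_f] -> involutive f.
  by case=> [<-|[<-|[]]]; [exact: along_arrowK | exact: along_sideK].
apply/eqP; rewrite -(eqn_pmul2r (isT : 0 < 4)%N).
rewrite (card_orbits_uniform fsK (n := 4)) ?card_arrow_end; last first.
  move=> [[e i] h].
  have -> : 4%N = #|[set ((e, jl.1, jl.2) : T) | jl in {: bool * bool}]|.
    rewrite card_imset ?card_prod ?card_bool //.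
    by move=> [j l] [j' l'] /= [-> ->].
  apply: eq_card => y; rewrite !inE /=; apply/idP/imsetP; last first.
    by case=> [[j l] _ ->]; apply: block_connect.
  move/(invariant_connect (c := fun z : T => z.1.1)) => /= <-; last first.
    by move=> f [[e' i'] h'] [<-|[<-|[]]].
  by exists (y.1.2, y.2) => //; case: y => [[]].
by rewrite mulnC.
Qed.

(** Each orbit is a union of pairs of [x] and [s x] with equal values of [u], so its scalar product
    with [u] vanishes mod 2. *)
Lemma orthogonal_orbit_mx fs s (u : 'rV[K]_#|T|) :
  (forall f, List.In f fs -> involutive f) -> List.In s fs ->
  (forall x, s x != x) -> (forall x, fun_of u (s x) = fun_of u x) ->
  u *m (orbit_mx K fs)^T = 0.
Proof.
move=> fsK sfs s_neq us; apply/rowP=> i; rewrite mul_orbit_mxT mxE.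
apply: (sum_involution_char2 K2 (fsK _ sfs) s_neq) => x.
by rewrite us orbit_of_invariant.
Qed.

(* The vanishing of the first homology of the sphere with coefficients in
   [F_2]: a cycle of the medial graph is the coboundary of a 2-colouring of its
   black faces ([p]) and of its white faces ([q]).  Both spaces of functions on
   the arrow ends have dimension [#|edge G| + 1]. *)
Lemma plane_cycle_split (g : T -> K) :
  plane G -> (forall x, g (arc x) = g x) ->
  (forall e, g (e, false, false) + g (e, false, true)
             + (g (e, true, false) + g (e, true, true)) = 0) ->
  exists p q : T -> K,
    [/\ invariant_fun [:: arrow_f; arc_f] p,
        invariant_fun [:: side_f; arc_f] q
      & forall x, g x = p x + q x].
Proof.
move=> [comp1 euler] g_arc g_cycle.
pose Vs := [:: arrow_f; arc_f]; pose Fs := [:: side_f; arc_f].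
pose As := [:: arc_f]; pose Bs := [:: arrow_f; side_f].
pose Cs := [:: arrow_f; side_f; arc_f].
have CK f : List.In f Cs -> involutive f.
  by case=> [<-|[<-|[<-|[]]]];
    [exact: along_arrowK | exact: along_sideK | exact: arcK].
have VK f : List.In f Vs -> involutive f by move=> ?; apply/CK; simpl in *; tauto.
have FK f : List.In f Fs -> involutive f by move=> ?; apply/CK; simpl in *; tauto.
have AK f : List.In f As -> involutive f by move=> ?; apply/CK; simpl in *; tauto.
have BK f : List.In f Bs -> involutive f by move=> ?; apply/CK; simpl in *; tauto.
have cC := etrans (esym (card_sum_ord (orbit_type Cs) (bare G))) comp1.
have cVF := etrans (esym (congr2 addn (card_sum_ord (orbit_type Vs) (bare G))
  (card_sum_ord (orbit_type Fs) (bare G)))) euler.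
have arith := sphere_dimension cC cVF card_arc_orbits card_block_orbits
  (card_arrow_end E).
have capVF : \rank (orbit_mx K Vs :&: orbit_mx K Fs)%MS = #|{: orbit_type Cs}|.
  by apply: (rank_cap_orbit_mx K VK FK CK) => f; split; simpl; tauto.
have capAB : \rank (orbit_mx K As :&: orbit_mx K Bs)%MS = #|{: orbit_type Cs}|.
  by apply: (rank_cap_orbit_mx K AK BK CK) => f; split; simpl; tauto.
(* [g] is orthogonal to every arc, being equal on its two ends, and to every edge block by
   [g_cycle]. *)
have : (vec_of g <= orbit_mx K Vs + orbit_mx K Fs)%MS.
  apply: (sub_sum_orthogonal _ _ (rank_orbit_mx K Vs) (rank_orbit_mx K Fs)
    (rank_orbit_mx K As) (rank_orbit_mx K Bs) capVF capAB).
  - move=> u /(sub_orbit_mxP VK) inv_u; split.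
      apply: (orthogonal_orbit_mx AK (s := arc_f)) => [|x|x]; first by left.
        exact: arc_neq.
      by apply: inv_u; right; left.
    apply: (orthogonal_orbit_mx BK (s := arrow_f)) => [|x|x]; first by left.
      exact: along_arrow_neq.
    by apply: inv_u; left.
  - move=> u /(sub_orbit_mxP FK) inv_u; split.
      apply: (orthogonal_orbit_mx AK (s := arc_f)) => [|x|x]; first by left.
        exact: arc_neq.
      by apply: inv_u; right; left.
    apply: (orthogonal_orbit_mx BK (s := side_f)) => [|x|x]; first by right; left.
      exact: along_side_neq.
    by apply: inv_u; left.
  - exact: arith.
  - apply: (orthogonal_orbit_mx AK (s := arc_f)) => [|x|x]; first by left.
      exact: arc_neq.
    by rewrite !fun_of_vecK.
  - apply/rowP=> i; rewrite mul_orbit_mxT mxE sum_arrow_end big1 // => e _.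
    have blk j l : orbit_of Bs (e, j, l) = orbit_of Bs (e, false, false).
      by apply/eqP; rewrite orbit_of_eq //; apply: block_connect.
    by rewrite !blk !fun_of_vecK -!mulrDl g_cycle mul0r.
case/sub_addsmxP=> -[w1 w2] /= gE.
exists (fun_of (w1 *m orbit_mx K Vs)), (fun_of (w2 *m orbit_mx K Fs)); split.
- exact/(sub_orbit_mxP VK)/submxMl.
- exact/(sub_orbit_mxP FK)/submxMl.
- by move=> x; rewrite -(fun_of_vecK g) gE /fun_of mxE.
Qed.

Definition white_agree (X : eqType) (c : T -> X) (e : E) : bool :=
  (c (e, false, true) == c (e, true, false))
  && (c (e, true, true) == c (e, false, false)).

Definition crossing_agree (X : eqType) (c : T -> X) (e : E) : bool :=
  (c (e, false, false) == c (e, true, false))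
  && (c (e, false, true) == c (e, true, true)).

(* [p] sums to zero over the half-edges of colour [b], which [arc] pairs.
   Grouped by medial vertices, the same sum counts the crossings of [b] with a
   smaller colour. *)
Lemma even_crossings_below k (c : T -> 'I_k) (b : 'I_k) :
  plane G -> (forall x, c (arc x) = c x) ->
  (forall e, white_agree c e != crossing_agree c e) ->
  \sum_e (crossing_agree c e
          && (maxn (c (e, false, false)) (c (e, false, true)) == b))%:R = 0 :> K.
Proof.
move=> planeG c_arc c_adm.
(* The half-edges of colour below [b] form a cycle: the colours at each vertex agree in pairs,
   whichever agreement holds. *)
have [x|e|p [q [p_inv q_inv g_split]]] :=
  @plane_cycle_split (fun x => (c x < b)%N%:R) planeG.
- by rewrite c_arc.
- move: (c_adm e); rewrite /white_agree /crossing_agree.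
  case: (boolP (_ && _)) => [/andP[/eqP-> /eqP->] _|_ /=].
    by rewrite [X in _ + X]addrC addrr_pchar2.
  rewrite eq_sym eqbF_neg negbK => /andP[/eqP-> /eqP->].
  by rewrite addrr_pchar2.
transitivity (\sum_x (c x == b)%:R * p x : K); last first.
  apply: (sum_involution_char2 K2 (@arcK G) (@arc_neq G)) => x.
  by rewrite c_arc p_inv //; right; left.
rewrite sum_arrow_end; apply: eq_bigr => e _.
have p_arrow i : p (e, i, true) = p (e, i, false).
  by rewrite -(p_inv arrow_f (e, i, false)) //; left.
have q_side i h : q (e, ~~ i, ~~ h) = q (e, i, h).
  by rewrite -(q_inv side_f (e, i, h)) //; left.
have [g0 g1 g2 g3] := And4 (g_split (e, false, false)) (g_split (e, false, true))
  (g_split (e, true, false)) (g_split (e, true, true)).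
rewrite (q_side true false) in g1; rewrite (q_side false false) in g3.
move: (c_adm e) g0 g1 g2 g3; rewrite /white_agree /crossing_agree !p_arrow.
(* If the white pairs agree, [p] has the same value on both arrows of [e], and the four terms cancel
   in pairs. *)
case: (boolP (_ && _)) => [/andP[/eqP c12 /eqP c30]|nW].
  case: (boolP (_ && _)) => //= _ _; rewrite c12 c30 => _ -> /addIr p02 _.
  by rewrite p02 [X in _ + X]addrC addrr_pchar2.
rewrite eq_sym eqbF_neg negbK => cX; move: nW; rewrite cX /=.
case/andP: cX => /eqP-> /eqP->; rewrite negb_and => nc.
have {nc} nc : c (e, true, true) != c (e, true, false).
  by case/orP: nc.
move: nc; set u := c (e, true, false); set v := c (e, true, true).
set p0 := p (e, false, false); set p2 := p (e, true, false).
set q0 := q (e, false, false) => nc g0 _ _ g3.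
(* One side of [e] joins the ends of [g0] and [g3], so both contain [q0], which cancels mod 2. *)
have p02 : p0 + p2 = (u < b)%N%:R + (v < b)%N%:R.
  by rewrite g0 g3 addrACA addrr_pchar2 ?addr0.
(* It remains that [([u = b] + [v = b]) * ([u < b] + [v < b])] is [[max(u, v) = b]] for distinct [u]
   and [v]. *)
rewrite addrACA -!mulrDr p02 -mulrDl -!val_eqE /=.
move: nc; rewrite -val_eqE /=; case: (ltngtP u v) => //= uv _.
- case: (ltngtP v b) => vb /=.
  + by rewrite (ltn_trans uv vb) (ltn_eqF (ltn_trans uv vb)) addr0 mul0r.
  + by rewrite addr0; case: (ltngtP u b); rewrite ?add0r ?mul0r ?mulr0.
  + by rewrite -vb uv (ltn_eqF uv) add0r addr0 mulr1.
- case: (ltngtP u b) => ub /=.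
  + by rewrite (ltn_trans uv ub) (ltn_eqF (ltn_trans uv ub)) addr0 mul0r.
  + by rewrite add0r; case: (ltngtP v b); rewrite ?addr0 ?mul0r ?mulr0.
  + by rewrite -ub uv (ltn_eqF uv) addr0 add0r mulr1.
Qed.

(** Each crossing is counted for exactly one [b], the larger of its two colours. *)
Lemma even_crossings k (c : T -> 'I_k) :
  plane G -> (forall x, c (arc x) = c x) ->
  (forall e, white_agree c e != crossing_agree c e) ->
  ~~ odd #|[set e | crossing_agree c e]|.
Proof.
move=> planeG c_arc c_adm; rewrite -dvdn2 (dvdn_pcharf K2); apply/eqP.
transitivity (\sum_(b < k) \sum_e (crossing_agree c e
    && (maxn (c (e, false, false)) (c (e, false, true)) == b))%:R : K).
  rewrite -sum1_card natr_sum big_mkcond exchange_big; apply: eq_bigr => e _ /=.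
  rewrite inE; case: (crossing_agree c e) => /=; last by rewrite big1.
  have mk : (maxn (c (e, false, false)) (c (e, false, true)) < k)%N.
    by rewrite gtn_max !ltn_ord.
  rewrite (bigD1 (Ordinal mk)) //= eqxx big1 ?addr0 // => b.
  by rewrite -val_eqE eq_sym => /negbTE->.
by apply: big1 => b _; apply: even_crossings_below.
Qed.

End Sphere.

(** * Counting colourings of curves *)

Section Colourings.
Variable G : embedded_graph.
Notation E := (edge G).
Notation T := (arrow_end E).
Notation arc_f := (@arc G).

(** These are exactly the Penrose states, encoded by the set of edges where they cross. *)
Definition crossing_state (A : {set E}) : state G :=
  [ffun e => if e \in A then crossing else white_split].

Definition state_colouring (X : eqType) (A : {set E}) (c : T -> X) : bool :=
  [forall x, c (arc x) == c x]
  && [forall e, if e \in A then crossing_agree c e else white_agree c e].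

(** For a colouring of the curves of a state, this says that the two strands through each [e] have
    different colours. *)
Definition locally_distinct (X : eqType) (c : T -> X) : bool :=
  [forall e, ~~ (white_agree c e && crossing_agree c e)].

Lemma state_pairingK (s : state G) : involutive (state_pairing s).
Proof. by case=> [[e i] h] /=; case se: (s e); rewrite /= se ?negbK. Qed.

Lemma state_colouringP (X : eqType) A (c : T -> X) :
  reflect (invariant_fun [:: state_pairing (crossing_state A); arc_f] c)
          (state_colouring A c).
Proof.
apply: (iffP andP) => [[/forallP c_arc /forallP c_st] f x | inv_c].
  case=> [<-|[<-|[]]]; last exact/eqP.
  case: x => [[e i] h]; rewrite /= ffunE; move: (c_st e).
  by case: (e \in A) => /andP[/eqP c1 /eqP c2]; case: i h => [] [] /=.
split; apply/forallP; first by move=> x; apply/eqP/inv_c; right; left.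
move=> e.
have st i h := inv_c (state_pairing (crossing_state A)) (e, i, h)
  (or_introl (erefl _)).
have := st false false; have := st false true.
have := st true false; have := st true true; rewrite /= !ffunE.
case: (e \in A) => /= c11 c10 c01 c00; apply/andP.
  by rewrite c00 c01.
by rewrite c01 c00.
Qed.

Lemma card_curve_colourings A k :
  (k ^ #|curve (crossing_state A)|
   = #|[set c : {ffun T -> 'I_k} | state_colouring A c]| * k ^ bare G)%N.
Proof.
have fsK f : List.In f [:: state_pairing (crossing_state A); arc_f] -> involutive f.
  by case=> [<-|[<-|[]]]; [exact: state_pairingK | exact: arcK].
have := card_orbit_colourings fsK (bare G) xpredT
  (fun c : {ffun T -> 'I_k} => state_colouringP A c).
rewrite card_ord => /esym cardE.
transitivity #|[set c : {ffun curve (crossing_state A) -> 'I_k} | true]|.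
  by rewrite cardsT card_ffun card_ord.
rewrite -cardE; congr (_ * _)%N.
by apply: eq_card => c; rewrite !inE andbT.
Qed.

(** The arrows of the dual are the sides of the edge discs, and a half-twist turns the two sides at
    [e] into the opposite pairs. So the vertices of the dual are the curves of [crossing_state A],
    and a colouring is proper when the two strands at each edge differ. *)
Lemma num_colourings_dual_petrial A k :
  num_colourings (underlying (dual (partial_petrial A))) k
  = (#|[set c : {ffun T -> 'I_k} | state_colouring A c && locally_distinct c]|
     * k ^ bare G)%N.
Proof.
pose H := dual (partial_petrial A).
pose fs := [:: @along_arrow E; @arc H].
have fsK f : List.In f fs -> involutive f.
  by case=> [<-|[<-|[]]]; [exact: along_arrowK | exact: (@arcK H)].
pose I (c : {ffun T -> 'I_k}) :=
  [forall x, c (along_arrow x) == c x] && [forall x, c (@arc H x) == c x].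
have IP (c : {ffun T -> 'I_k}) : reflect (invariant_fun fs c) (I c).
  apply: (iffP andP) => [[/forallP c1 /forallP c2] f x | inv_c].
    by case=> [<-|[<-|[]]]; apply/eqP.
  by split; apply/forallP=> x; apply/eqP/inv_c; [left | right; left].
pose P (c : {ffun T -> 'I_k}) := [forall e, c (e, false, false) != c (e, true, false)].
transitivity #|[set c : {ffun orbit_type fs + 'I_(bare G) -> 'I_k}
    | P [ffun x => c (inl (orbit_of fs x))]]|.
  apply: eq_card => c; rewrite !inE; apply: eq_forallb => e.
  by rewrite !ffunE.
rewrite (card_orbit_colourings fsK _ P IP) card_ord; congr (_ * _)%N.
(* [h] translates the names of arrow ends in [H] into those in [G]. *)
pose h (x : T) : T := reverse_arrows A (dual_end x).
pose h' (x : T) : T := dual_end_inv (reverse_arrows A x).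
have hK : cancel h h' by move=> x; rewrite /h /h' reverse_arrowsK dual_endK.
have h'K : cancel h' h by move=> x; rewrite /h /h' dual_end_invK reverse_arrowsK.
have arcE x : h (@arc H x) = arc (h x) by exact: h'K.
pose phi (c : {ffun T -> 'I_k}) : {ffun T -> 'I_k} := [ffun x => c (h x)].
have phi_bij : bijective phi.
  exists (fun c : {ffun T -> 'I_k} => [ffun x => c (h' x)]) => c;
    by apply/ffunP=> x; rewrite !ffunE ?hK ?h'K.
rewrite -(on_card_preimset (onW_bij _ phi_bij)); apply: eq_card => c.
rewrite !inE /I /P /state_colouring /locally_distinct.
have -> : [forall x, phi c (@arc H x) == phi c x] = [forall x, c (arc x) == c x].
  apply/forallP/forallP=> cH x; last by rewrite !ffunE arcE.
  by have := cH (h' x); rewrite !ffunE arcE h'K.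
rewrite [X in X && _ = _]andbC -!andbA; congr (_ && _).
rewrite /phi /h /white_agree /crossing_agree.
(* Label by label, equality along the dual arrows is the agreement prescribed by [A], and distinct
   end colours rule out the other one. *)
apply/andP/andP=> -[/forallP cA /forallP cD]; split; apply/forallP.
- move=> e; have := cA (e, false, false); have := cA (e, true, false).
  rewrite !ffunE /=; case: (e \in A) => /= /eqP-> /eqP->; by rewrite !eqxx.
- move=> e; have := cA (e, false, false); have := cA (e, true, false).
  have := cD e; rewrite !ffunE /=.
  case: (e \in A) => /= + /eqP c1 /eqP c2; apply: contraNN;
    by move=> /andP[/andP[/eqP w1 /eqP w2] /andP[/eqP x1 /eqP x2]];
    apply/eqP; congruence.
- case=> [[e i] l]; have := cA e; rewrite !ffunE /=.
  by case: (e \in A) => /= /andP[/eqP c1 /eqP c2]; case: i l => [] [];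
    apply/eqP => /=; congruence.
- move=> e; have := cA e; have := cD e; rewrite !ffunE /=.
  case: (e \in A) => /= + /andP[/eqP c1 /eqP c2]; apply: contraNN => /eqP c3;
    by repeat (apply/andP; split); apply/eqP; congruence.
Qed.

End Colourings.

(** * Evaluation at natural numbers and comparison of the two sums *)

Lemma natr_card_set (R : nzSemiRingType) (I : finType) (b : pred I) :
  #|[set i | b i]|%:R = \sum_i (b i)%:R :> R.
Proof.
rewrite -sum1_card natr_sum big_mkcond; apply: eq_bigr => i _.
by rewrite inE; case: (b i).
Qed.

Lemma prod_natr_bool (R : comNzRingType) (I : finType) (b : pred I) :
  \prod_i (b i)%:R = [forall i, b i]%:R :> R.
Proof.
case: forallP => [bT | /forallP/forallPn[i bi]].
  by rewrite big1 // => i _; rewrite bT.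
by rewrite (bigD1 i) //= (negbTE bi) mul0r.
Qed.

(** In the expanded product, [A] is the set of indices whose factor contributes [t * X i]. The
    signed sum takes [t = -1], the plain count [t = 1]. *)
Lemma sum_sets_weighted (R : comNzRingType) (I : finType) (t : R) (X W : pred I) :
  \sum_(A : {set I}) t ^+ #|A| * [forall i, if i \in A then X i else W i]%:R
  = \prod_i (t * (X i)%:R + (W i)%:R).
Proof.
rewrite bigA_distr /=; apply: eq_bigr => A _.
rewrite -prod_natr_bool -prodr_const big_mkcond -big_split /=.
by apply: eq_bigr => i _; case: (i \in A); rewrite ?mul1r.
Qed.

Lemma poly_eq_nat (p q : {poly int}) :
  (forall k : nat, p.[k%:R] = q.[k%:R]) -> p = q.
Proof.
move=> pq; apply/eqP; rewrite -subr_eq0; apply/negPn/negP => nz.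
pose rs := [seq (k%:R : int) | k <- iota 0 (size (p - q))].
have urs : uniq rs.
  by rewrite map_inj_uniq ?iota_uniq // => i j /eqP; rewrite eqr_nat => /eqP.
have ars : all (root (p - q)) rs.
  by apply/allP=> _ /mapP[k _ ->]; rewrite rootE hornerD hornerN pq subrr.
by have := max_poly_roots nz ars urs; rewrite size_map size_iota ltnn.
Qed.

Lemma penrose_polyE (G : embedded_graph) (k : nat) :
  (penrose_poly G).[k%:R]
  = \sum_(A : {set edge G}) (-1) ^+ #|A| * (k ^ #|curve (crossing_state A)|)%:R.
Proof.
rewrite /penrose_poly horner_sum.
rewrite (reindex_onto (@crossing_state G) (fun s => [set e | s e == crossing])) /=.
  apply: eq_big => [A|A _].
    have -> : [set e | crossing_state A e == crossing] = A.
      by apply/setP=> e; rewrite inE ffunE; case: (e \in A).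
    rewrite eqxx andbT; apply/forallP=> e; rewrite ffunE.
    by case: (e \in A).
  rewrite hornerZ hornerXn natrX /num_crossings; congr (_ ^+ _ * _).
  by apply: eq_card => e; rewrite inE ffunE; case: (e \in A).
move=> s /forallP s_pen; apply/ffunP=> e; rewrite ffunE inE.
by move: (s_pen e); case: (s e).
Qed.

(** If [c] has exactly one agreement at each vertex, only the state crossing where the opposite
    pairs agree fits it, with sign +1 by [even_crossings]. Every other [c] contributes zero to both
    sides. *)
Lemma plane_signed_sum (G : embedded_graph) k
    (c : {ffun arrow_end (edge G) -> 'I_k}) : plane G ->
  \sum_(A : {set edge G}) (-1) ^+ #|A| * (state_colouring A c)%:R
  = \sum_(A : {set edge G}) (state_colouring A c && locally_distinct c)%:R :> int.
Proof.
move=> planeG; rewrite /state_colouring.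
case: (boolP [forall x, _]) => [/forallP c_arc|_] /=; last first.
  by rewrite !big1 // => A _; rewrite mulr0.
rewrite sum_sets_weighted.
case: (boolP [forall e, white_agree c e != crossing_agree c e]).
  move/forallP=> c_adm.
  have -> : locally_distinct c.
    apply/forallP=> e; have := c_adm e.
    by case: (white_agree c e); case: (crossing_agree c e).
  transitivity ((-1) ^+ #|[set e | crossing_agree c e]| : int).
    rewrite -prodr_const [in RHS]big_mkcond; apply: eq_bigr => e _; rewrite inE.
    by have := c_adm e; case: (white_agree c e); case: (crossing_agree c e).
  rewrite -signr_odd (negbTE (even_crossings planeG _ c_adm)); last first.
    by move=> x; apply/eqP.
  transitivity (\prod_e (1 * (crossing_agree c e)%:R + (white_agree c e)%:R) : int).
    rewrite big1 // => e _.
    by have := c_adm e; case: (white_agree c e); case: (crossing_agree c e).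
  rewrite -sum_sets_weighted; apply: eq_bigr => A _.
  by rewrite expr1n mul1r andbT.
(* Both agreements hold at [e] or neither does. The factor at [e] vanishes on the left; on the right
   [locally_distinct] fails in the first case and [state_colouring] in the second. *)
case/forallPn=> e; rewrite negbK => /eqP We.
rewrite (bigD1 e) //= We mulN1r addNr mul0r big1 // => A _.
case: (boolP (_ && _)) => // /andP[/forallP/(_ e) + /forallP/(_ e)].
by rewrite We; case: (e \in A) => ->.
Qed.

Theorem theorem7p2 (G : embedded_graph) (hG : plane G) :
  penrose_poly G =
  \sum_(A : {set edge G})
     chromatic_poly (underlying (dual (partial_petrial A))).
Proof.
apply: poly_eq_nat => k; rewrite penrose_polyE horner_sum.
transitivity (\sum_(c : {ffun arrow_end (edge G) -> 'I_k})
  (\sum_(A : {set edge G}) (-1) ^+ #|A| * (state_colouring A c)%:R)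
  * (k ^ bare G)%:R : int).
  rewrite -mulr_suml exchange_big mulr_suml; apply: eq_bigr => A _ /=.
  by rewrite -mulr_sumr card_curve_colourings natrM mulrA natr_card_set.
rewrite -mulr_suml (eq_bigr _ (fun c _ => plane_signed_sum c hG)).
rewrite exchange_big mulr_suml; apply: eq_bigr => A _ /=.
by rewrite chromatic_polyP num_colourings_dual_petrial natrM natr_card_set.
Qed.
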